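(* Let $(M,J,g)$ be a $(J^2=\pm1)$-metric manifold, i.e. a manifold with an $(\alpha,\varepsilon)$-structure $(J,g)$, satisfying $\alpha\varepsilon=-1$. Let $\mathrm{T}^0$ be the torsion tensor of its first canonical connection $\nabla^0$. Then $(M,J,g)$ is a nearly Kähler type manifold if and only if $$g(\mathrm{T}^0(X,Y),X)=0,\quad\forall X,Y\in\mathfrak{X}(M).$$
   Context: $M$ is a smooth manifold, $\mathfrak{X}(M)$ is the set of vector fields on $M$, and $Id$ is the identity tensor field. For $\alpha,\varepsilon\in\{-1,1\}$, an $(\alpha,\varepsilon)$-structure on $M$ is a pair $(J,g)$ of a $(1,1)$-tensor field $J$ and a semi-Riemannian metric $g$ with $J^2=\alpha Id$ and $g(JX,JY)=\varepsilon g(X,Y)$ for all $X,Y\in\mathfrak{X}(M)$; then $(M,J,g)$ is called a $(J^2=\pm1)$-metric manifold. If $\varepsilon=1$, $g$ is Riemannian; if $\varepsilon=-1$, $g$ has signature $(n,n)$ with $\dim M=2n$. The case $\alpha\varepsilon=-1$ comprises almost Hermitian manifolds ($\alpha=-1,\varepsilon=1$) and almost para-Hermitian manifolds ($\alpha=1,\varepsilon=-1$). $\nabla^{\mathrm g}$ denotes the Levi Civita connection of $g$. $(M,J,g)$ is a nearly Kähler type manifold if $(\nabla^{\mathrm g}_XJ)X=0$ for all $X\in\mathfrak{X}(M)$; equivalently, $(\nabla^{\mathrm g}_XJ)Y+(\nabla^{\mathrm g}_YJ)X=0$ for all $X,Y\in\mathfrak{X}(M)$. The first canonical connection of $(M,J,g)$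 is $$\nabla^0_XY=\nabla^{\mathrm g}_XY+\frac{(-\alpha)}{2}(\nabla^{\mathrm g}_XJ)JY,\quad X,Y\in\mathfrak{X}(M),$$ and its torsion tensor is $\mathrm{T}^0(X,Y)=\nabla^0_XY-\nabla^0_YX-[X,Y]$. *)

(* Defs.v *)
From HB Require Import structures.
From mathcomp Require Import all_boot all_order all_algebra.
From mathcomp Require Import boolp classical_sets functions cardinality reals.
From mathcomp Require Import topology normedtype derive.

Set Implicit Arguments.
Unset Strict Implicit.
Unset Printing Implicit Defensive.

Import Order.TTheory GRing.Theory Num.Theory.
Import numFieldNormedType.Exports.

Local Open Scope classical_set_scope.
Local Open Scope ring_scope.

Section SmoothFunctions.
Variables (R : realType) (n : nat).

(* A function is C^(k+1) on an open set iff it is differentiable there and its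
   first partial derivatives are C^k. *)
Fixpoint Ck_on (k : nat) (U : set 'rV[R]_n) (f : 'rV[R]_n -> R) : Prop :=
  match k with
  | 0 => forall x, U x -> {for x, continuous f}
  | k'.+1 => (forall x, U x -> differentiable f x) /\
             (forall i : 'I_n,
                Ck_on k' U (fun x => 'D_(delta_mx 0 i : 'rV[R]_n) f x))
  end.

Definition smooth_on (U : set 'rV[R]_n) (f : 'rV[R]_n -> R) : Prop :=
  forall k, Ck_on k U f.

End SmoothFunctions.

(* The maps are total; they are only meaningful on [chart_dom] and on its image
   [chart_map @` chart_dom], between which they are inverse homeomorphisms. *)
Record chart (R : realType) (n : nat) (M : topologicalType) := Chart {
  chart_dom : set M;
  chart_map : M -> 'rV[R]_n;
  chart_inv : 'rV[R]_n -> M;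
  chart_dom_open : open chart_dom;
  chart_img_open : open (chart_map @` chart_dom);
  chart_mapK : forall p, chart_dom p -> chart_inv (chart_map p) = p;
  chart_map_cont : {within chart_dom, continuous chart_map};
  chart_inv_cont : {within chart_map @` chart_dom, continuous chart_inv}
}.

(* [chart_at p] is a chosen chart of the atlas around [p].  The atlas need not
   be maximal: it determines the smooth structure. *)
Record smoothManifold (R : realType) (n : nat) := SmoothManifold {
  mfld_carrier :> topologicalType;
  mfld_hausdorff : hausdorff_space mfld_carrier;
  mfld_second_countable : @second_countable mfld_carrier;
  atlas : set (chart R n mfld_carrier);
  chart_at : mfld_carrier -> chart R n mfld_carrier;
  chart_at_atlas : forall p, atlas (chart_at p);
  chart_at_dom : forall p, chart_dom (chart_at p) p;
  atlas_compat : forall c c' : chart R n mfld_carrier, atlas c -> atlas c' ->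
    forall i : 'I_n,
      smooth_on (chart_map c @` (chart_dom c `&` chart_dom c'))
                (fun x => chart_map c' (chart_inv c x) 0 i)
}.

Section Tensors.
Variables (R : realType) (n : nat) (M : smoothManifold R n).

Definition smooth_fun (f : M -> R) : Prop :=
  forall c, atlas c ->
    smooth_on (chart_map c @` chart_dom c) (f \o chart_inv c).

(* The tangent space T_pM is R^n, a row vector v standing for the tangent vector
   \sum_i v_i d/dx^i at p in the coordinates x of [chart_at p].  A field of
   tangent vectors, resp. of endomorphisms, resp. of bilinear forms, is thus a
   function on M with values in 'rV_n, resp. in 'M_n (acting on row vectors from
   the right), resp. in 'M_n (Gram matrices).  Since [chart_at p] varies with p,
   their smoothness is not that of these coordinate functions: it is tested on
   smooth functions, resp. on smooth vector fields. *)
Definition vfield : Type := M -> 'rV[R]_n.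

Definition tderive (p : M) (v : 'rV[R]_n) (f : M -> R) : R :=
  'D_v (f \o chart_inv (chart_at p)) (chart_map (chart_at p) p).

Definition vf_app (X : vfield) (f : M -> R) : M -> R :=
  fun p => tderive p (X p) f.

Definition smooth_vf (X : vfield) : Prop :=
  forall f, smooth_fun f -> smooth_fun (vf_app X f).

(* [X, Y]^i = X (Y x^i) - Y (X x^i) at p, for the coordinates x^i around p. *)
Definition lie_bracket (X Y : vfield) : vfield := fun p =>
  let x (i : 'I_n) : M -> R := fun q => chart_map (chart_at p) q 0 i in
  \row_i (vf_app X (vf_app Y (x i)) p - vf_app Y (vf_app X (x i)) p).

Definition endo_app (J : M -> 'M[R]_n) (X : vfield) : vfield :=
  fun p => X p *m J p.

Definition form_app (g : M -> 'M[R]_n) (X Y : vfield) : M -> R :=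
  fun p => (X p *m g p *m (Y p)^T) 0 0.

Definition smooth_endo (J : M -> 'M[R]_n) : Prop :=
  forall X, smooth_vf X -> smooth_vf (endo_app J X).

Definition smooth_form (g : M -> 'M[R]_n) : Prop :=
  forall X Y, smooth_vf X -> smooth_vf Y -> smooth_fun (form_app g X Y).

(* Every g_p has an orthonormal basis (the rows of P) with r vectors of square 1
   and s vectors of square -1. *)
Definition has_signature (g : M -> 'M[R]_n) (r s : nat) : Prop :=
  (r + s = n)%N /\
  forall p, exists2 P : 'M[R]_n, P \in unitmx &
    P *m g p *m P^T = diag_mx (\row_i (if (i < r)%N then 1 else -1)).

Record semi_riemannian (g : M -> 'M[R]_n) : Prop := SemiRiemannian {
  metric_smooth : smooth_form g;
  metric_sym : forall p, (g p)^T = g p;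
  metric_nondeg : forall p, g p \in unitmx;
  metric_signature : exists r s, has_signature g r s
}.

Definition positive_definite (g : M -> 'M[R]_n) : Prop :=
  forall p (v : 'rV[R]_n), v != 0 -> 0 < (v *m g p *m v^T) 0 0.

Record alpha_eps_structure (alpha eps : R) (J g : M -> 'M[R]_n) : Prop :=
  AlphaEpsStructure {
    ae_alpha : alpha = 1 \/ alpha = -1;
    ae_eps : eps = 1 \/ eps = -1;
    ae_endo : smooth_endo J;
    ae_metric : semi_riemannian g;
    ae_square : forall p, J p *m J p = alpha%:M;
    ae_compat : forall X Y, smooth_vf X -> smooth_vf Y -> forall p,
      form_app g (endo_app J X) (endo_app J Y) p = eps * form_app g X Y p;
    ae_riemannian : eps = 1 -> positive_definite g;
    ae_neutral : eps = -1 -> exists2 m, n = (2 * m)%N & has_signature g m m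
  }.

(* Connections are constrained on smooth vector fields only. *)
Definition connection : Type := vfield -> vfield -> vfield.

Record is_connection (nabla : connection) : Prop := IsConnection {
  conn_smooth : forall X Y, smooth_vf X -> smooth_vf Y ->
    smooth_vf (nabla X Y);
  conn_addl : forall X X' Y, smooth_vf X -> smooth_vf X' -> smooth_vf Y ->
    forall p, nabla (fun q => X q + X' q) Y p = nabla X Y p + nabla X' Y p;
  conn_mull : forall f X Y, smooth_fun f -> smooth_vf X -> smooth_vf Y ->
    forall p, nabla (fun q => f q *: X q) Y p = f p *: nabla X Y p;
  conn_addr : forall X Y Y', smooth_vf X -> smooth_vf Y -> smooth_vf Y' ->
    forall p, nabla X (fun q => Y q + Y' q) p = nabla X Y p + nabla X Y' p;
  conn_leibniz : forall f X Y, smooth_fun f -> smooth_vf X -> smooth_vf Y ->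
    forall p, nabla X (fun q => f q *: Y q) p
              = vf_app X f p *: Y p + f p *: nabla X Y p
}.

Definition torsion (nabla : connection) (X Y : vfield) : vfield :=
  fun p => nabla X Y p - nabla Y X p - lie_bracket X Y p.

Record levi_civita (g : M -> 'M[R]_n) (nabla : connection) : Prop :=
  LeviCivita {
    lc_connection : is_connection nabla;
    lc_torsion_free : forall X Y, smooth_vf X -> smooth_vf Y ->
      forall p, torsion nabla X Y p = 0;
    lc_metric : forall X Y Z, smooth_vf X -> smooth_vf Y -> smooth_vf Z ->
      forall p, vf_app X (form_app g Y Z) p
        = form_app g (nabla X Y) Z p + form_app g Y (nabla X Z) p
  }.

(* (nabla_X J) Y *)
Definition cov_endo (nabla : connection) (J : M -> 'M[R]_n) (X Y : vfield)
    : vfield :=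
  fun p => nabla X (endo_app J Y) p - endo_app J (nabla X Y) p.

(* [nabla] is the Levi-Civita connection of the metric. *)
Definition nearly_kahler_type (nabla : connection) (J : M -> 'M[R]_n) : Prop :=
  forall X, smooth_vf X -> forall p, cov_endo nabla J X X p = 0.

Definition first_canonical (nabla : connection) (alpha : R) (J : M -> 'M[R]_n)
    : connection :=
  fun X Y p =>
    nabla X Y p + (- alpha / 2) *: cov_endo nabla J X (endo_app J Y) p.

End Tensors.

(* Main.v *)
From mathcomp Require Import all_boot all_order all_algebra reals topology.
From mathcomp Require Import boolp classical_sets functions.
From mathcomp Require Import normedtype sequences landau derive realfun exp.
From mathcomp Require Import ring lra.
Require Import Defs.

(** The metric is compatible with the Levi-Civita connection, and the condition
    [alpha * eps = -1] makes [J] skew-adjoint for [g].  Write [D_X] for the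
    covariant derivative of [J] along [X].  Differentiating the skewness of [J]
    shows that [D_X] is skew-adjoint too ([cov_endo_skew]), and differentiating
    [J^2 = alpha] shows that [D_X] anticommutes with [J]
    ([cov_endo_anticomm]).  Since the Levi-Civita connection has no torsion,
    [T0(X,Y) = - alpha/2 (D_X (J Y) - D_Y (J X))].  The composite of two
    anticommuting skew-adjoint maps is skew-adjoint, so that
    [g(D_Y (J X), X) = 0]; moving [D_X] to the other side in the other term
    gives ([form_torsion])
      [g(T0(X,Y), X) = alpha/2 g(J Y, D_X X)].
    The nearly Kaehler condition [D_X X = 0] makes the right-hand side vanish;
    conversely, as [J] is invertible and [g] is nondegenerate, the vanishing of
    the right-hand side for all [Y] forces [D_X X = 0].

    The converse quantifies over smooth vector fields [Y] on the whole
    manifold, while nondegeneracy of [g] is a statement on each tangent space.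
    When [g] is indefinite it therefore needs that every tangent vector is the
    value of a global smooth vector field ([smooth_vf_through]), and most of
    the text is about this.  Such a field is a constant field in one chart,
    multiplied by a bump function and extended by zero.  It requires the
    calculus of C^k functions on open subsets of R^n (sums, products,
    composition, chain rule) and a smooth function on R that vanishes exactly
    on the nonpositive half-line. *)

Set Implicit Arguments.
Unset Strict Implicit.
Unset Printing Implicit Defensive.

Import Order.TTheory GRing.Theory Num.Theory.
Import numFieldNormedType.Exports.

Local Open Scope classical_set_scope.
Local Open Scope ring_scope.

(** * Calculus of C^k functions on open subsets of R^n *)

(** The difference of the two functions vanishes near [x], hence is
    differentiable there with differential 0. *)
Lemma near_eq_differentiable (R : realType) (V W : normedModType R)
    (f h : V -> W) (x : V) :
  (\forall y \near x, f y = h y) -> differentiable f x -> differentiable h x.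
Proof.
move=> fh df; have -> : h = f + (h - f) by rewrite addrC subrK.
apply: differentiableD => //; set e := h - f.
have e0 : \forall y \near x, e y = 0.
  by apply: filterS fh => y /= fhy; rewrite -[LHS]/(h y - f y) fhy subrr.
have eo : e \o shift x = cst (e x) + (\0 : V -> W) +o_ 0 id.
  apply/eqaddoP => eps eps0; near=> y.
  have ey : e (y + x) = 0.
    near: y; have := e0; rewrite (near_shift 0) /= => H.
    by apply: filterS H => y /=; rewrite subr0.
  by rewrite !fctE /= ey (nbhs_singleton e0) addr0 subrr normr0 mulr_ge0 // ltW.
have c0 : continuous (\0 : V -> W) by move=> y; exact: cst_continuous.
apply/diff_locallyP; rewrite (diff_unique c0 eo); split => //.
Unshelve. all: by end_near. Qed.

Section CkCalculus.
Variables (R : realType) (n : nat).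
Implicit Types (U V : set 'rV[R]_n) (f h : 'rV[R]_n -> R) (k : nat).

Lemma open_near U x (P : 'rV[R]_n -> Prop) : open U -> U x ->
  (forall y, U y -> P y) -> \forall y \near x, P y.
Proof.
by move=> oU Ux UP; apply: filterS (open_nbhs_nbhs (conj oU Ux)); exact: UP.
Qed.

Lemma Ck_on_sub k U V f : V `<=` U -> Ck_on k U f -> Ck_on k V f.
Proof.
move=> VU; elim: k f => [|k IH] f /=; first by move=> cf x /VU; exact: cf.
by move=> [df Cf]; split=> [x /VU|i]; [exact: df | exact: IH].
Qed.

Lemma eq_Ck_on k U f h : open U -> (forall x, U x -> f x = h x) ->
  Ck_on k U f -> Ck_on k U h.
Proof.
move=> oU; elim: k f h => [|k IH] f h fh.
  move=> cf x Ux; have := cf x Ux.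
  rewrite /prop_for /continuous_at -(fh x Ux) => cfx.
  by apply: cvg_trans cfx; exact: (near_eq_cvg (open_near oU Ux fh)).
move=> [df Cf]; split=> [x Ux|i].
  by apply: near_eq_differentiable (df x Ux); exact: (open_near oU Ux fh).
by apply: IH (Cf i) => x Ux; apply: near_eq_derive; exact: (open_near oU Ux fh).
Qed.

(** Each of the conditions that make up C^k bears on a single point, where any
    of the sets [V] may witness it. *)
Lemma Ck_on_local k U f :
  (forall x, U x -> exists2 V, V x & Ck_on k V f) -> Ck_on k U f.
Proof.
elim: k f => [|k IH] f loc /=.
  by move=> x /loc[V Vx cf]; exact: cf.
split=> [x /loc[V Vx [df _]]|i]; first exact: df.
by apply: IH => x /loc[V Vx [_ Cf]]; exists V => //; exact: Cf.
Qed.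

Lemma Ck_onS k U f : Ck_on k.+1 U f -> Ck_on k U f.
Proof.
elim: k f => [|k IH] f [df Cf]; last by split=> // i; exact/IH/Cf.
by move=> x Ux; exact/differentiable_continuous/df.
Qed.

Lemma Ck_on_cst k U (a : R) : Ck_on k U (cst a).
Proof.
elim: k a => [|k IH] a; first by move=> x _; exact: cst_continuous.
split=> [x _|i]; first exact: differentiable_cst.
rewrite [X in Ck_on _ _ X](_ : _ = cst 0) //.
by apply/funext => x; rewrite derive_cst.
Qed.

(** The coordinates of the derivative of the identity map. *)
Lemma derive_coord (x v : 'rV[R]_n) j :
  'D_v (fun y : 'rV[R]_n => y 0 j) x = v 0 j.
Proof.
have := derive_mx (@derivable_id _ _ x v).
by rewrite derive_id => /matrixP/(_ 0 j) ->; rewrite mxE.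
Qed.

Lemma Ck_on_coord k U j : Ck_on k U (fun x => x 0 j).
Proof.
case: k => [|k]; first by move=> x _; exact: coord_continuous.
have dc (x : 'rV[R]_n) : differentiable (fun y : 'rV[R]_n => y 0 j : R) x.
  exact: differentiable_coord.
split=> // i.
rewrite [X in Ck_on _ _ X](_ : _ = cst ((delta_mx 0 i : 'rV[R]_n) 0 j)).
  exact: Ck_on_cst.
by apply/funext => x; rewrite derive_coord.
Qed.

Lemma Ck_onD k U f h : open U -> Ck_on k U f -> Ck_on k U h ->
  Ck_on k U (f + h).
Proof.
move=> oU; elim: k f h => [|k IH] f h.
  by move=> cf ch x Ux; apply: continuousD; [exact: cf | exact: ch].
move=> [df Cf] [dh Ch]; split=> [x Ux|i].
  by apply: differentiableD; [exact: df | exact: dh].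
apply: eq_Ck_on (IH _ _ (Cf i) (Ch i)) => // x Ux.
by rewrite deriveD //; apply: diff_derivable; [exact: df | exact: dh].
Qed.

(** By the Leibniz rule, the partial derivatives of [f * h] involve [f] and [h]
    themselves, which are C^k as well by [Ck_onS]. *)
Lemma Ck_onM k U f h : open U -> Ck_on k U f -> Ck_on k U h ->
  Ck_on k U (f * h).
Proof.
move=> oU; elim: k f h => [|k IH] f h.
  by move=> cf ch x Ux; apply: continuousM; [exact: cf | exact: ch].
move=> Cf Ch; have [[df Df] [dh Dh]] := (Cf, Ch); split=> [x Ux|i].
  by apply: differentiableM; [exact: df | exact: dh].
apply: eq_Ck_on (Ck_onD oU (IH _ _ (Ck_onS Cf) (Dh i))
                           (IH _ _ (Ck_onS Ch) (Df i))) => // x Ux.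
by rewrite deriveM //; apply: diff_derivable; [exact: df | exact: dh].
Qed.

Lemma Ck_on_sum k U (I : Type) (s : seq I) (F : I -> 'rV[R]_n -> R) : open U ->
  (forall i, Ck_on k U (F i)) -> Ck_on k U (\sum_(i <- s) F i).
Proof.
move=> oU CF; elim/big_ind : _ => [|f h|i _].
- exact: Ck_on_cst.
- exact: Ck_onD.
- exact: CF.
Qed.


Lemma differentiable_row (phi : 'rV[R]_n -> 'rV[R]_n) (x : 'rV[R]_n) :
  (forall i, differentiable (fun y => phi y 0 i) x) -> differentiable phi x.
Proof.
move=> dphi.
have -> : phi = \sum_(i < n) (fun y => phi y 0 i *: delta_mx 0 i).
  by apply/funext => y; rewrite fct_sumE [LHS]row_sum_delta.
by apply: differentiable_sum => i; exact/differentiableZl/dphi.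
Qed.

Lemma derive_sum_coord f (x v : 'rV[R]_n) : differentiable f x ->
  'D_v f x = \sum_i v 0 i * 'D_(delta_mx 0 i) f x.
Proof.
move=> df; rewrite deriveE // {1}[v]row_sum_delta linear_sum /=.
by apply: eq_bigr => i _; rewrite linearZ deriveE.
Qed.

(** The chain rule in the form used for changes of charts: it says how the
    components of a tangent vector transform. *)
Lemma derive_comp_row f (phi : 'rV[R]_n -> 'rV[R]_n) (x v : 'rV[R]_n) :
  (forall i, differentiable (fun y => phi y 0 i) x) ->
  differentiable f (phi x) ->
  'D_v (f \o phi) x = 'D_(\row_i 'D_v (fun y => phi y 0 i) x) f (phi x).
Proof.
move=> /differentiable_row dphi df.
rewrite deriveE; last exact: differentiable_comp.
rewrite diff_comp //= -(deriveE _ dphi) -(deriveE _ df).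
rewrite derive_mx; last exact: diff_derivable.
by congr ('D_ _ f _); apply/rowP => i; rewrite !mxE.
Qed.

(** Induction on [k]: the chain rule writes a partial derivative of [f \o phi] as
    a sum of products of a partial derivative of [phi], which is smooth, with
    the composite of a partial derivative of [f] with [phi], to which the
    induction hypothesis applies. *)
Lemma Ck_on_comp k U V f (phi : 'rV[R]_n -> 'rV[R]_n) :
  open U -> (forall x, U x -> V (phi x)) ->
  (forall i, smooth_on U (fun x => phi x 0 i)) ->
  Ck_on k V f -> Ck_on k U (f \o phi).
Proof.
move=> oU UV Sphi.
have dphi x i : U x -> differentiable (fun y => phi y 0 i) x.
  by move=> Ux; have [+ _] := Sphi i 1%N; exact.
elim: k f => [|k IH] f.
  move=> cf x Ux; apply: continuous_comp; last exact/cf/UV.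
  by apply/differentiable_continuous/differentiable_row => i; exact: dphi.
move=> [df Cf]; split=> [x Ux|i].
  apply: differentiable_comp; last exact/df/UV.
  by apply: differentiable_row => i; exact: dphi.
apply: (@eq_Ck_on _ _
  (\sum_j ((fun x => 'D_(delta_mx 0 i) (fun y => phi y 0 j) x) *
           ((fun x => 'D_(delta_mx 0 j) f x) \o phi)))) => //.
  move=> x Ux; rewrite derive_comp_row; last 2 first.
  - by move=> j; exact: dphi.
  - exact/df/UV.
  rewrite derive_sum_coord; last exact/df/UV.
  by rewrite fct_sumE; apply: eq_bigr => j _; rewrite mxE.
apply: Ck_on_sum => // j; apply: Ck_onM => //; last exact/IH/Cf.
by have [_] := Sphi j k.+1; exact.
Qed.

Lemma smooth_on_derive U f (v : 'rV[R]_n) : open U -> smooth_on U f ->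
  smooth_on U (fun x => 'D_v f x).
Proof.
move=> oU Sf k.
apply: (@eq_Ck_on _ _ (\sum_i (cst (v 0 i) *
          (fun x => 'D_(delta_mx 0 i) f x)))) => //.
  move=> x Ux; rewrite derive_sum_coord; first by rewrite fct_sumE.
  by have [+ _] := Sf 1%N; exact.
apply: Ck_on_sum => // i; apply: Ck_onM => //; first exact: Ck_on_cst.
by have [_] := Sf k.+1; exact.
Qed.

End CkCalculus.

(** * Bump functions *)

Section Flat.
Variable R : realType.
Implicit Types (m : nat) (t : R).

(** The function [exp (- 1 / t)], extended by 0, is treated together with its
    products with powers of [1 / t]: the span of this family is stable under
    differentiation, so that its members become smooth all at once. *)
Definition flat m t : R :=
  if 0 < t then t^-1 ^+ m * expR (- t^-1) else 0.

Lemma flat_ge0 m t : 0 <= flat m t.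
Proof.
rewrite /flat; case: ifPn => // t0.
by rewrite mulr_ge0 ?expR_ge0 // exprn_ge0 // invr_ge0 ltW.
Qed.

(** With [s = 1 / t], this is [s ^ (m + 1) / (m + 1)! <= exp s].  Through
    [flat_div], this linear bound also controls the difference quotients at 0. *)
Lemma flat_le m t : flat m t <= (m.+1)`!%:R * `|t|.
Proof.
rewrite /flat; case: ifPn => t0; last by rewrite mulr_ge0.
rewrite gtr0_norm // expRN ler_pdivrMr ?expR_gt0 //.
have ti0 : 0 <= t^-1 by rewrite invr_ge0 ltW.
have : (t^-1) ^+ m.+1 / (m.+1)`!%:R <= expR t^-1.
  by apply: le_trans (expR_ge1Dxn m ti0); rewrite lerDr.
rewrite ler_pdivrMr ?ltr0n ?fact_gt0 // => H.
rewrite -(ler_pM2l (_ : 0 < t^-1)) ?invr_gt0 // -exprS (le_trans H) //.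
by rewrite (mulrC _ t) -mulrA mulKf ?gt_eqF // mulrC.
Qed.

Lemma flat_div m t : t^-1 * flat m t = flat m.+1 t.
Proof. by rewrite /flat; case: ifPn; rewrite ?mulr0 // exprS mulrA. Qed.

(** At 0, the difference quotient of [flat m] is [flat m.+1], which tends to 0 by
    [flat_le]. *)
Lemma flat_is_derive m t :
  is_derive t 1 (flat m) (flat m.+2 t - m%:R * flat m.+1 t).
Proof.
have [t0|t0|->] := ltgtP t 0.
- rewrite [X in is_derive _ _ _ X](_ : _ = 0); last first.
    by rewrite /flat ltNge (ltW t0) /= mulr0 subr0.
  apply: (@near_eq_is_derive _ _ _ (cst 0)) => //.
  near=> s; rewrite /flat ifF //; apply/negbTE; rewrite -leNgt ltW //.
  by near: s; exact: lt_nbhsl.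
- apply: (@near_eq_is_derive R R R (fun s : R => s^-1 ^+ m * expR (- s^-1) : R)).
    near=> s; rewrite /flat ifT //.
    by near: s; exact: lt_nbhsr.
  have tN0 : t != 0 by rewrite gt_eqF.
  have dV : is_derive t 1 (fun s : R => s^-1) (- t ^- 2 *: 1).
    exact: (@is_deriveV _ id).
  have dX := is_deriveX m dV.
  have dE : is_derive t 1 (expR \o (fun s : R => - s^-1))
                      (expR (- t^-1) * - (- t ^- 2 *: 1)).
    exact: is_derive1_comp.
  have -> : (fun s : R => s^-1 ^+ m * expR (- s^-1) : R) =
            (fun s : R => s^-1) ^+ m * (expR \o (fun s : R => - s^-1)).
    by apply/funext => s; rewrite -[RHS]/((_ ^+ m) s * _) exprfctE.
  apply: is_derive_eq (is_deriveM dX dE) _.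
  rewrite exprfctE /= /flat t0 /GRing.scale /= mulr1 -exprVn.
  by case: m {dX} => [|m] /=; rewrite ?exprS; ring.
- rewrite [X in is_derive _ _ _ X](_ : _ = 0); last first.
    by rewrite /flat ltxx mulr0 subr0.
  have c0 : (fun h : R => h^-1 *: ((flat m \o shift 0) (h *: 1) - flat m 0))
              @ 0^' --> (0 : R).
    apply: (@squeeze_cvgr _ _ _ _ (cst 0) (fun h => (m.+2)`!%:R * `|h|)).
    + near=> h; rewrite /= [flat m 0]/flat ltxx subr0 addr0 /GRing.scale /=.
      by rewrite mulr1 flat_div flat_ge0 flat_le.
    + exact: cvg_cst.
    + rewrite -[X in _ --> X](mulr0 (m.+2)`!%:R).
      apply: cvgMr; rewrite -[X in _ --> X](@normr0 _ R).
      by apply: cvg_norm; exact: cvg_within.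
  by apply: DeriveDef; [apply/cvg_ex; exists 0 | exact: cvg_lim].
Unshelve. all: by end_near. Qed.

End Flat.

Section FlatComp.
Variables (R : realType) (n : nat).
Implicit Types (U : set 'rV[R]_n) (u : 'rV[R]_n -> R).

(** Induction on the order of differentiability, for all [m] at once: a partial
    derivative of [flat m \o u] is a combination of [flat m.+1 \o u] and
    [flat m.+2 \o u] with smooth coefficients. *)
Lemma smooth_flat_comp m U u : open U -> smooth_on U u ->
  smooth_on U (flat m \o u).
Proof.
move=> oU Su k; have du x : U x -> differentiable u x.
  by move=> Ux; have [+ _] := Su 1%N; exact.
have df (l : nat) (t : R) : differentiable (flat l) t.
  by apply/derivable1_diffP; have [] := flat_is_derive l t.
elim: k m => [|k IH] m.
  move=> x Ux; apply: differentiable_continuous.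
  by apply: differentiable_comp => //; exact: du.
split=> [x Ux|i]; first by apply: differentiable_comp => //; exact: du.
apply: (@eq_Ck_on _ _ _ _
  (((flat m.+2 \o u) + cst (- m%:R) * (flat m.+1 \o u)) *
   (fun x => 'D_(delta_mx 0 i) u x))) => //.
  move=> x Ux; rewrite [RHS]deriveE; last first.
    by apply: differentiable_comp => //; exact: du.
  rewrite diff_comp //; last exact: du.
  rewrite /= deriv1E; last by case: (flat_is_derive m (u x)).
  rewrite -deriveE; last exact: du.
  rewrite derive1E; have [_ ->] := flat_is_derive m (u x).
  by rewrite /= mulNr mulrC.
apply: Ck_onM => //; last by have [_] := Su k.+1; exact.
by apply: Ck_onD => //; apply: Ck_onM => //; exact: Ck_on_cst.
Qed.

(** A radial bump function [flat 0 (s^2 - |x - x0|^2)], for the Euclidean norm.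
    The compact set is a cube of half-side [s], the closed ball for the norm of
    row vectors; it contains the Euclidean ball outside of which the function
    vanishes. *)
Lemma smooth_bump (x0 : 'rV[R]_n) U : open U -> U x0 ->
  exists (psi : 'rV[R]_n -> R) (K : set 'rV[R]_n),
    [/\ smooth_on setT psi, psi x0 != 0, compact K, K `<=` U
      & forall x, ~ K x -> psi x = 0].
Proof.
move=> oU Ux0.
have /nbhs_ballP[r /= r0 rU] := open_nbhs_nbhs (conj oU Ux0).
(* Halving the radius puts the closed cube inside the open ball. *)
pose s := r / 2; have s0 : 0 < s by rewrite divr_gt0.
pose d i := (fun x : 'rV[R]_n => x 0 i) + cst (- x0 0 i).
pose u := cst (s ^+ 2) + cst (-1) * \sum_(i < n) d i * d i.
have uE x : u x = s ^+ 2 - \sum_(i < n) (x 0 i - x0 0 i) ^+ 2.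
  rewrite -[LHS]/(s ^+ 2 + -1 * (\sum_(i < n) d i * d i) x) mulN1r fct_sumE.
  by congr (_ - _); apply: eq_bigr => i _; rewrite expr2.
pose K :=
  [set x : 'rV[R]_n | forall i, x ord0 i \in `[x0 0 i - s, x0 0 i + s]].
exists (flat 0 \o u), K; split.
- apply: smooth_flat_comp; first exact: openT.
  move=> k; apply: Ck_onD; [exact: openT | exact: Ck_on_cst | ].
  apply: Ck_onM; [exact: openT | exact: Ck_on_cst | ].
  apply: Ck_on_sum; [exact: openT | move=> i].
  have : Ck_on k setT (d i).
    by apply: Ck_onD; [exact: openT | exact: Ck_on_coord | exact: Ck_on_cst].
  by move=> ?; apply: Ck_onM; first exact: openT.
- rewrite /= uE big1 ?subr0; last by move=> i _; rewrite subrr expr0n.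
  by rewrite /flat exprn_gt0 // expr0 mul1r gt_eqF // expR_gt0.
- apply: (@rV_compact _ _ (fun i => `[x0 0 i - s, x0 0 i + s]%classic)) => i.
  exact: segment_compact.
- move=> x Kx; apply: rU; rewrite -ball_normE /= /ball_ /=.
  rewrite [ltLHS]/Num.Def.normr /= mx_normrE; apply: bigmax_lt => // -[a i] _ /=.
  rewrite (ord1 a) !mxE distrC; have := Kx i.
  rewrite in_itv /= -ler_distl => /le_lt_trans; apply.
  by rewrite /s; lra.
- move=> x NK; rewrite /= /flat ifF //; apply/negbTE; rewrite -leNgt uE subr_le0.
  have [i Ni] : exists i, ~ (x ord0 i \in `[x0 0 i - s, x0 0 i + s]).
    by apply/existsNP.
  rewrite (bigD1 i) //= ler_wpDr ?sumr_ge0 // => [j _|]; first exact: sqr_ge0.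
  move/negP: Ni; rewrite in_itv /= -ler_distl -ltNge => /ltW H.
  by rewrite -[leRHS]real_normK ?num_real // lerXn2r // nnegrE ?normr_ge0 // ltW.
Qed.

End FlatComp.

(** * Global smooth vector fields through a tangent vector *)

Section VectorFields.
Variables (R : realType) (n : nat) (M : smoothManifold R n).
Implicit Types (c : chart R n M) (f : M -> R) (p q : M) (X Y : vfield M).

Lemma open_chart_image c (A : set M) : open A ->
  open (chart_map c @` (chart_dom c `&` A)).
Proof.
move=> oA; have cc := @chart_inv_cont _ _ _ c.
rewrite continuous_open_subspace in cc; last exact: chart_img_open.
have /(_ A oA) := (continuous_inP _ (@chart_img_open _ _ _ c)).1 cc.
congr open; apply/seteqP; split=> [x [[q qc <-]]|x [q [qc qA] <-]] /=.
  by rewrite chart_mapK // => qA; exists q.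
by split; [exists q | rewrite /= chart_mapK].
Qed.

Lemma smooth_fun_cst (a : R) : smooth_fun (cst a : M -> R).
Proof. by move=> c _ k; exact: Ck_on_cst. Qed.

Lemma smooth_fun_differentiable f c q : smooth_fun f -> atlas c ->
  chart_dom c q -> differentiable (f \o chart_inv c) (chart_map c q).
Proof.
by move=> Sf ac qc; have [+ _] := Sf c ac 1%N; apply; exists q.
Qed.

Lemma transition_differentiable c c' q i : atlas c -> atlas c' ->
  chart_dom c q -> chart_dom c' q ->
  differentiable (fun x => chart_map c' (chart_inv c x) 0 i) (chart_map c q).
Proof.
move=> ac ac' qc qc'; have [+ _] := atlas_compat ac ac' i 1%N.
by apply; exists q.
Qed.

(** The tangent vector at [q] that has components [v] in the chart [c], written
    in the coordinates of [chart_at q]. *)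
Definition push c (v : 'rV[R]_n) q : 'rV[R]_n :=
  \row_i 'D_v (fun x => chart_map (chart_at q) (chart_inv c x) 0 i)
              (chart_map c q).

(** Derivatives along a tangent vector may be computed in any chart of the
    atlas, by the chain rule for the transition map. *)
Lemma tderive_push c v f q : smooth_fun f -> atlas c -> chart_dom c q ->
  tderive q (push c v q) f = 'D_v (f \o chart_inv c) (chart_map c q).
Proof.
move=> Sf ac qc; set c' := chart_at q.
have ac' : atlas c' := chart_at_atlas q.
have qc' : chart_dom c' q := chart_at_dom q.
pose phi := chart_map c' \o chart_inv c.
have phiq : phi (chart_map c q) = chart_map c' q by rewrite /phi /= chart_mapK.
have E : 'D_v ((f \o chart_inv c') \o phi) (chart_map c q) =
         'D_v (f \o chart_inv c) (chart_map c q).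
  apply: near_eq_derive.
  have oc' : open (chart_map c @` (chart_dom c `&` chart_dom c')).
    exact/open_chart_image/chart_dom_open.
  apply: (open_near oc'); first by exists q.
  by move=> _ [r [rc rc'] <-]; rewrite /phi /= chart_mapK // chart_mapK.
rewrite -E derive_comp_row; last 2 first.
- by move=> i; exact: transition_differentiable.
- by rewrite phiq; exact: smooth_fun_differentiable.
by rewrite phiq.
Qed.

Lemma push_at p v : push (chart_at p) v p = v.
Proof.
apply/rowP => i; rewrite mxE -[RHS](derive_coord (chart_map (chart_at p) p)).
apply: near_eq_derive; apply: (open_near (@chart_img_open _ _ _ (chart_at p))).
  by exists p => //; exact: chart_at_dom.
by move=> _ [q qc <-]; rewrite chart_mapK.
Qed.

Definition local_vf c (psi : 'rV[R]_n -> R) v : vfield M := fun q =>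
  if `[< chart_dom c q >] then psi (chart_map c q) *: push c v q else 0.

Lemma vf_app_local_vf c psi v f q : smooth_fun f -> atlas c ->
  vf_app (local_vf c psi v) f q =
  if `[< chart_dom c q >]
  then psi (chart_map c q) * 'D_v (f \o chart_inv c) (chart_map c q) else 0.
Proof.
move=> Sf ac; rewrite /vf_app /local_vf; case: asboolP => qc; last exact: derive0.
have df := smooth_fun_differentiable Sf (chart_at_atlas q) (chart_at_dom q).
rewrite -tderive_push // /tderive.
by rewrite (deriveE _ df) linearZ -(deriveE _ df).
Qed.

(** A point of another chart either lies in the domain of [c], where the field
    acts as a smooth multiple of a constant-coefficient derivation, or lies off
    the image in [M] of the compact set [K].  That image is compact, hence closed
    as [M] is Hausdorff, so that the field vanishes near the point in the second
    case. *)
Lemma smooth_local_vf c psi v (K : set 'rV[R]_n) : atlas c ->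
  smooth_on setT psi -> compact K -> K `<=` chart_map c @` chart_dom c ->
  (forall x, ~ K x -> psi x = 0) -> smooth_vf (local_vf c psi v).
Proof.
move=> ac Spsi cK KU psi0 f Sf c' ac' k.
have oU := @chart_img_open _ _ _ c.
have clK : closed (chart_inv c @` K).
  apply: compact_closed; first exact: mfld_hausdorff.
  apply: continuous_compact cK.
  by apply: continuous_subspaceW KU _; exact: chart_inv_cont.
apply: Ck_on_local => _ [q qc' <-].
have [qc|qNc] := pselect (chart_dom c q).
  have oV := @open_chart_image c' _ (chart_dom_open c).
  exists (chart_map c' @` (chart_dom c' `&` chart_dom c)); first by exists q.
  apply: (@eq_Ck_on _ _ _ _ ((psi * (fun x => 'D_v (f \o chart_inv c) x)) \o
                           (chart_map c \o chart_inv c'))) => //.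
    move=> _ [r [rc' rc] <-].
    by rewrite /= chart_mapK // vf_app_local_vf // asboolT.
  apply: (@Ck_on_comp _ _ _ _ (chart_map c @` chart_dom c)) => //.
  - by move=> _ [r [rc' rc] <-]; rewrite /= chart_mapK //; exists r.
  - by move=> i; exact: atlas_compat.
  apply: Ck_onM => //; first exact: Ck_on_sub (Spsi k).
  by apply: smooth_on_derive => //; exact: Sf.
have oV := @open_chart_image c' _ (closed_openC clK).
exists (chart_map c' @` (chart_dom c' `&` ~` (chart_inv c @` K))).
  exists q => //; split => // -[x /KU[r rc <-]]; rewrite chart_mapK // => rq.
  by apply: qNc; rewrite -rq.
apply: (@eq_Ck_on _ _ _ _ (cst 0)) => //; last exact: Ck_on_cst.
move=> _ [r [rc' rNK] <-]; rewrite /= chart_mapK // vf_app_local_vf //.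
case: asboolP => // rc; rewrite psi0 ?mul0r // => Kr; apply: rNK.
by exists (chart_map c r) => //; rewrite chart_mapK.
Qed.

(** This turns a property of the values of all smooth vector fields at [p] into
    a property of all tangent vectors at [p]. *)
Lemma smooth_vf_through p (v : 'rV[R]_n) :
  exists2 X : vfield M, smooth_vf X & X p = v.
Proof.
have pc := chart_at_dom p; have ac := chart_at_atlas p.
have [|psi [K [Spsi psi0 cK KU psiK]]] :=
    @smooth_bump _ _ (chart_map (chart_at p) p) _
      (@chart_img_open _ _ _ (chart_at p)).
  by exists p.
(* The bump function need not be 1 at [p]: [v] is rescaled by its value. *)
exists (local_vf (chart_at p) psi ((psi (chart_map (chart_at p) p))^-1 *: v)).
  exact: smooth_local_vf cK KU psiK.
by rewrite /local_vf asboolT // push_at scalerA mulfV // scale1r.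
Qed.

End VectorFields.

(** * Bilinear forms given by a Gram matrix *)

Section Bilinear.
Variables (R : realType) (n : nat) (G : 'M[R]_n).
Implicit Types u v w : 'rV[R]_n.

(** [form_app g X Y p] is convertible to [bil (g p) (X p) (Y p)]; this form lets
    tangent vectors at [p] replace vector fields. *)
Definition bil u w : R := (u *m G *m w^T) 0 0.

Lemma bilDl u v w : bil (u + v) w = bil u w + bil v w.
Proof. by rewrite /bil !mulmxDl mxE. Qed.

Lemma bilZl (a : R) u w : bil (a *: u) w = a * bil u w.
Proof. by rewrite /bil -!scalemxAl mxE. Qed.

Lemma bilNl u w : bil (- u) w = - bil u w.
Proof. by rewrite -scaleN1r bilZl mulN1r. Qed.

Lemma bilDr u v w : bil u (v + w) = bil u v + bil u w.
Proof. by rewrite /bil linearD mulmxDr mxE. Qed.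

Lemma bilZr (a : R) u w : bil u (a *: w) = a * bil u w.
Proof. by rewrite /bil linearZ -scalemxAr mxE. Qed.

Lemma bilNr u w : bil u (- w) = - bil u w.
Proof. by rewrite -scaleN1r bilZr mulN1r. Qed.

Lemma bilC u w : G^T = G -> bil u w = bil w u.
Proof.
move=> GT; rewrite /bil -[in LHS](trmxK (u *m G *m w^T)) mxE.
by rewrite !trmx_mul trmxK GT mulmxA.
Qed.

Lemma bil_nondeg w : G \in unitmx -> (forall u, bil u w = 0) -> w = 0.
Proof.
move=> Gu w0; have Gw : G *m w^T = 0.
  apply/colP => i; have := w0 (delta_mx 0 i).
  by rewrite /bil -mulmxA -rowE !mxE.
by apply: trmx_inj; rewrite trmx0 -[LHS](mulKmx Gu) Gw mulmx0.
Qed.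

End Bilinear.

(** * The torsion of the first canonical connection *)

Section FirstCanonical.
Variables (R : realType) (n : nat) (M : smoothManifold R n).
Variables (alpha eps : R) (J g : M -> 'M[R]_n) (nabla : connection M).
Hypothesis hJg : alpha_eps_structure alpha eps J g.
Hypothesis hae : alpha * eps = -1.
Hypothesis hnabla : levi_civita g nabla.
Implicit Types (X Y Z : vfield M) (p : M).

Lemma structure_sqr : alpha * alpha = 1.
Proof. by case: (ae_alpha hJg) => ->; ring. Qed.

(** The compatibility of [J] with [g] speaks of smooth vector fields;
    [smooth_vf_through] brings it to each tangent space, where it says that [J]
    is skew-adjoint because [J^-1 = alpha J] and [alpha * eps = -1]. *)
Lemma structure_skew p u w : bil (g p) (u *m J p) w = - bil (g p) u (w *m J p).
Proof.
have [X SX Xu] := smooth_vf_through p u.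
have [Y SY Yw] := smooth_vf_through p (w *m J p).
have := ae_compat hJg SX SY p.
rewrite /form_app /endo_app Xu Yw -(mulmxA w) (ae_square hJg) mul_mx_scalar.
rewrite -!/(bil _ _ _) bilZr => /(congr1 ( *%R alpha)).
by rewrite !mulrA structure_sqr hae mul1r mulN1r.
Qed.

Let J_smooth X : smooth_vf X -> smooth_vf (endo_app J X).
Proof. exact: ae_endo hJg X. Qed.

(** Differentiate [g(J Y, Z) = - g(Y, J Z)] along [X] with the metric property of
    [nabla]. *)
Lemma cov_endo_skew X Y Z p : smooth_vf X -> smooth_vf Y -> smooth_vf Z ->
  bil (g p) (cov_endo nabla J X Y p) (Z p) =
  - bil (g p) (Y p) (cov_endo nabla J X Z p).
Proof.
move=> SX SY SZ.
have E1 := lc_metric hnabla SX (J_smooth SY) SZ p.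
have E2 := lc_metric hnabla SX SY (J_smooth SZ) p.
have S2 : smooth_fun (form_app g Y (endo_app J Z)).
  by apply: (metric_smooth (ae_metric hJg)) => //; exact: J_smooth.
have df := smooth_fun_differentiable S2 (chart_at_atlas p) (chart_at_dom p).
have fE : form_app g (endo_app J Y) Z = - form_app g Y (endo_app J Z).
  by apply/funext => q; exact: structure_skew.
have dN : vf_app X (- form_app g Y (endo_app J Z)) p =
          - vf_app X (form_app g Y (endo_app J Z)) p.
  by rewrite /vf_app /tderive -deriveN //; exact: diff_derivable.
move: E1; rewrite fE dN E2 /form_app -!/(bil _ _ _) => E1.
rewrite /cov_endo bilDl bilNl bilDr bilNr.
move: E1; rewrite /endo_app !(structure_skew p (Y p)).
rewrite (structure_skew p (nabla X Y p)).
lra.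
Qed.

(** Differentiate [J (J Y) = alpha Y] along [X]. *)
Lemma cov_endo_anticomm X Y p : smooth_vf X -> smooth_vf Y ->
  cov_endo nabla J X (endo_app J Y) p = - (cov_endo nabla J X Y p *m J p).
Proof.
move=> SX SY; have JJ : endo_app J (endo_app J Y) = fun q => cst alpha q *: Y q.
  by apply/funext => q; rewrite /endo_app -mulmxA (ae_square hJg) mul_mx_scalar.
have E : nabla X (endo_app J (endo_app J Y)) p = alpha *: nabla X Y p.
  rewrite JJ (conn_leibniz (lc_connection hnabla)) //; last exact: smooth_fun_cst.
  have -> : vf_app X (cst alpha) p = 0 by exact: derive_cst.
  by rewrite scale0r add0r.
rewrite /cov_endo E /endo_app mulmxBl -[X in _ = - (_ - X)]mulmxA (ae_square hJg).
by rewrite mul_mx_scalar opprB.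
Qed.

(** The composite of [J] with the covariant derivative of [J] is skew-adjoint,
    as both are skew-adjoint and they anticommute; the quadratic form of a
    skew-adjoint map is zero. *)
Lemma cov_endo_J_isotropic X Y p : smooth_vf X -> smooth_vf Y ->
  bil (g p) (cov_endo nabla J Y (endo_app J X) p) (X p) = 0.
Proof.
move=> SX SY; have := cov_endo_skew p SY (J_smooth SX) SX.
rewrite structure_skew opprK -(opprK (_ *m J p)) -cov_endo_anticomm //.
rewrite bilNr (bilC _ _ (metric_sym (ae_metric hJg) p)).
by set a := bil _ _ _ => E; lra.
Qed.

(** This identity contains the theorem.  [T0] has two terms, since [nabla] has no
    torsion: the one in [cov_endo nabla J Y] is killed by
    [cov_endo_J_isotropic], and skewness moves [cov_endo nabla J X] in the
    other from [J Y] to [X]. *)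
Lemma form_torsion X Y p : smooth_vf X -> smooth_vf Y ->
  form_app g (torsion (first_canonical nabla alpha J) X Y) X p =
  alpha / 2 * bil (g p) (endo_app J Y p) (cov_endo nabla J X X p).
Proof.
move=> SX SY; rewrite /form_app -/(bil _ _ _).
have -> : torsion (first_canonical nabla alpha J) X Y p =
   (- alpha / 2) *: (cov_endo nabla J X (endo_app J Y) p
                    - cov_endo nabla J Y (endo_app J X) p).
  have := lc_torsion_free hnabla SX SY p; rewrite /torsion /first_canonical => E.
  by rewrite [RHS]scalerBr opprD addrACA [LHS]addrAC E add0r.
rewrite bilZl bilDl bilNl cov_endo_J_isotropic // subr0 cov_endo_skew //.
  by ring.
exact: J_smooth.
Qed.

End FirstCanonical.

Theorem theorem4p2 (R : realType) (n : nat) (M : smoothManifold R n)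
    (alpha eps : R) (J g : M -> 'M[R]_n) (nabla : connection M)
    (hJg : alpha_eps_structure alpha eps J g)
    (hae : alpha * eps = -1)
    (hnabla : levi_civita g nabla) :
  nearly_kahler_type nabla J <->
  (forall X Y : vfield M, smooth_vf X -> smooth_vf Y -> forall p : M,
     form_app g (torsion (first_canonical nabla alpha J) X Y) X p = 0).
Proof.
split=> [NK X Y SX SY p|T0 X SX p].
  rewrite (form_torsion hJg hae hnabla) // NK //.
  by rewrite -(scale0r 0) bilZr mul0r mulr0.
apply: (bil_nondeg (metric_nondeg (ae_metric hJg) p)) => u.
(* As [J (J u) = alpha u], choosing [Y p = J u] makes [J Y] range over all
   tangent vectors at [p], up to the factor [alpha]. *)
have [Y SY Yu] := smooth_vf_through p (u *m J p).
have := T0 X Y SX SY p; rewrite (form_torsion hJg hae hnabla) //.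
rewrite /endo_app Yu -mulmxA (ae_square hJg) mul_mx_scalar bilZl mulrA.
rewrite (mulrAC alpha) (structure_sqr hJg) mul1r.
by move/eqP; rewrite mulf_eq0 invr_eq0 pnatr_eq0 /= => /eqP.
Qed.
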